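(* Let $A\in(0,+\infty)$ and consider the difference equation $$x_{n+1}=\frac{\max\{x_n^3,A\}}{x_n x_{n-1}},\qquad n\geq 0 .$$ For any positive initial conditions $(x_{-1},x_0)$, either $x_{-1}=x_0=\bar{x}$ is an equilibrium point, or the solution generated by them diverges to infinity. The stationary solution $(\bar{x},\bar{x},\bar{x},\ldots)$ appears for all the values $\bar{x}\geq\sqrt[3]{A}$.
   Context: An equilibrium point is a value $\bar{x}>0$ such that the constant sequence $\bar{x}$ is a solution. ''Diverges to infinity'' means $\lim_{n\to+\infty}x_n=+\infty$. *)

(* Defs.v *)
From mathcomp Require Import all_boot all_order all_algebra.
From mathcomp Require Import all_classical all_reals all_analysis.
Set Implicit Arguments.
Unset Strict Implicit.
Unset Printing Implicit Defensive.
Import Order.TTheory GRing.Theory Num.Theory.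
Import numFieldNormedType.Exports.
Local Open Scope ring_scope.

(* A sequence (x_n)_{n >= -1} is encoded with its indices shifted by one:
   [x k] stands for x_{k-1}, so [x 0] and [x 1] are the initial conditions
   x_{-1} and x_0, and [x n.+2] is x_{n+1}. *)
Definition is_solution (R : realType) (A : R) (x : nat -> R) : Prop :=
  forall n : nat,
    x n.+2 = Num.max (x n.+1 ^+ 3) A / (x n.+1 * x n).

Definition is_equilibrium (R : realType) (A xbar : R) : Prop :=
  0 < xbar /\ is_solution A (fun _ : nat => xbar).

(* Main.v *)
Require Import Defs.
From mathcomp Require Import all_boot all_order all_algebra.
From mathcomp Require Import all_classical all_reals all_analysis.
From mathcomp Require Import ring lra.
Import Order.TTheory GRing.Theory Num.Theory.
Import numFieldNormedType.Exports.
Local Open Scope classical_set_scope.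
Local Open Scope ring_scope.

(* The recursion gives x_{n+2} x_n >= x_{n+1}^2 and x_{n+2} x_{n+1} x_n >= A.
   The first inequality says that x is log-convex, hence convex, so one strict
   increase forces divergence. If x is nonincreasing, the second inequality
   gives x_n^3 >= A for all n, so x_{n+2} x_n = x_{n+1}^2 and 1/x is log-convex
   as well; a strict decrease would make 1/x diverge, although it stays
   bounded. So x is constant. *)

(** The increments of [y] are nondecreasing, so each is at least the first one. *)
Lemma convex_seq_ge (R : realType) (y : nat -> R) (n : nat) :
  (forall k, 2%:R * y k.+1 <= y k.+2 + y k) ->
  y 0%N + n%:R * (y 1%N - y 0%N) <= y n.
Proof.
move=> cvx.
have step k : y 1%N - y 0%N <= y k.+1 - y k.
  by elim: k => [//|k IH]; have := cvx k; lra.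
elim: n => [|n IH]; first by rewrite mul0r addr0.
by have := step n; rewrite -natr1; lra.
Qed.

Lemma convex_seq_cvgy (R : realType) (y : nat -> R) :
  (forall k, 2%:R * y k.+1 <= y k.+2 + y k) -> y 0%N < y 1%N ->
  y @ \oo --> +oo.
Proof.
move=> cvx y01.
have d0 : 0 < y 1%N - y 0%N by rewrite subr_gt0.
apply/cvgryPge => M; near=> n.
apply: le_trans (convex_seq_ge _ _ n cvx).
rewrite -lerBlDl -ler_pdivrMr//.
by near: n; apply: nbhs_infty_ger.
Unshelve. all: by end_near. Qed.

(** AM-GM: if [c + a < 2b], then [(c + a)^2 < 4 b^2 <= 4ca], against [(c - a)^2 >= 0]. *)
Lemma double_le_add_of_sqr_le_mul (R : realType) (a b c : R) :
  0 < a -> 0 < c -> b ^+ 2 <= c * a -> 2%:R * b <= c + a.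
Proof.
move=> a0 c0 h.
rewrite leNgt; apply/negP => hlt.
have := sqr_ge0 (c - a); rewrite !expr2 in h *.
by nra.
Qed.

Lemma log_convex_seq_cvgy (R : realType) (y : nat -> R) :
  (forall k, 0 < y k) -> (forall k, y k.+1 ^+ 2 <= y k.+2 * y k) ->
  (exists n, y n < y n.+1) -> y @ \oo --> +oo.
Proof.
move=> y0 lcvx [n yn].
(* Dropping the first [n] terms moves the strict increase to index 0. *)
rewrite -(cvg_shiftn n).
apply: convex_seq_cvgy; last exact: yn.
by move=> k; apply: double_le_add_of_sqr_le_mul; [exact: y0..|exact: (lcvx (k + n)%N)].
Qed.

Section Solution.
Variables (R : realType) (A : R) (x : nat -> R).
Hypotheses (A0 : 0 < A) (x00 : 0 < x 0%N) (x10 : 0 < x 1%N).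
Hypothesis solx : is_solution A x.

Lemma solution_gt0 n : 0 < x n.
Proof.
suff: 0 < x n /\ 0 < x n.+1 by case.
elim: n => [//|n [p q]]; split=> //.
by rewrite solx divr_gt0 ?mulr_gt0// lt_max A0 orbT.
Qed.

Lemma solution_mul n : x n.+2 * (x n.+1 * x n) = Num.max (x n.+1 ^+ 3) A.
Proof. by rewrite solx divfK// mulf_neq0 ?gt_eqF ?solution_gt0. Qed.

(** After multiplication by [x n.+1], the right side is the maximum and the left side is its first
    argument. *)
Lemma solution_log_convex n : x n.+1 ^+ 2 <= x n.+2 * x n.
Proof.
rewrite -(ler_pM2r (solution_gt0 n.+1)) -exprSr -mulrA (mulrC (x n)).
by rewrite solution_mul le_max lexx.
Qed.

(** The product of three consecutive terms is at least [A], and each factor is at most [x n]. *)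
Lemma nonincreasing_solution_cube_ge :
  (forall n, x n.+1 <= x n) -> forall n, A <= x n ^+ 3.
Proof.
move=> dec n.
have: A <= x n.+2 * (x n.+1 * x n) by rewrite solution_mul le_max lexx orbT.
move=> /le_trans; apply.
rewrite !exprS expr0 mulr1.
have x0 := solution_gt0.
have le2 := le_trans (dec n.+1) (dec n).
have x_ge0 k : 0 <= x k by exact: ltW.
by apply: ler_pM => //; rewrite ?mulr_ge0// ler_pM2r.
Qed.

Lemma nonincreasing_solution_const :
  (forall n, x n.+1 <= x n) -> x 1%N = x 0%N.
Proof.
move=> dec; have x0 := solution_gt0.
have cubeA := nonincreasing_solution_cube_ge dec.
(* Since [A <= x n.+1 ^+ 3], the maximum is the cube and log-convexity becomes an equality. *)
have geom n : x n.+2 * x n = x n.+1 ^+ 2.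
  apply: (mulIf (lt0r_neq0 (x0 n.+1))).
  by rewrite -exprSr -mulrA (mulrC (x n)) solution_mul max_l.
apply/eqP; rewrite eq_le dec leNgt; apply/negP => x10lt.
have inv_cvgy : (fun n => (x n)^-1) @ \oo --> +oo.
  apply: log_convex_seq_cvgy => [k|k|].
  - by rewrite invr_gt0.
  - by rewrite exprVn -invfM -geom mulrC.
  - by exists 0%N; rewrite ltf_pV2 ?posrE.
(* Such an [n] gives [x n <= 1] and [x n < A], hence [x n ^+ 3 <= x n < A], which contradicts
   [cubeA]. *)
have [n [inv1 invA]] : exists n, 1 <= (x n)^-1 /\ A^-1 < (x n)^-1.
  move/cvgryPgt: inv_cvgy => /(_ (Num.max 1 A^-1)) [n _ /(_ n (leqnn n))] /=.
  by rewrite gt_max => /andP[/ltW ? ?]; exists n.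
have xle1 : x n <= 1 by rewrite -invf_ge1.
have xltA : x n < A by rewrite -ltf_pV2 ?posrE.
have := lt_le_trans xltA (cubeA n).
by rewrite ltNge exprS ger_pMr// exprn_ile1// ltW.
Qed.

End Solution.

(** For a constant sequence the recursion reads [xbar^3 = max(xbar^3, A)]. *)
Lemma equilibriumP (R : realType) (A xbar : R) :
  is_equilibrium A xbar <-> 0 < xbar /\ A <= xbar ^+ 3.
Proof.
split=> -[x0 h]; split=> //.
  have /(congr1 ( *%R^~ (xbar * xbar))) := h 0%N.
  rewrite /= divfK ?mulf_neq0 ?gt_eqF// => e.
  have : A <= Num.max (xbar ^+ 3) A by rewrite le_max lexx orbT.
  by rewrite -e !exprS expr0 mulr1.
move=> n; rewrite max_l//.
by field; rewrite gt_eqF.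
Qed.

Theorem corollary2 (R : realType) (A : R) (hA : 0 < A) :
  (forall (a b : R) (x : nat -> R),
     0 < a -> 0 < b ->
     x 0%N = a -> x 1%N = b -> is_solution A x ->
     (exists xbar : R, [/\ a = xbar, b = xbar & is_equilibrium A xbar])
     \/ x @ \oo --> +oo)
  /\ (forall xbar : R, is_equilibrium A xbar <-> A `^ (3%:R^-1) <= xbar).
Proof.
split=> [a b x a0 b0 xa xb solx|xbar].
  subst a b.
  have x0 := solution_gt0 _ _ _ hA a0 b0 solx.
  have [inc|/forallNP ninc] := pselect (exists n, x n < x n.+1).
    right; apply: log_convex_seq_cvgy => // k.
    exact: (solution_log_convex _ _ _ hA).
  have dec n : x n.+1 <= x n by rewrite leNgt; apply/negP/ninc.
  left; exists (x 0%N); split=> //.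
    exact: (nonincreasing_solution_const _ _ _ hA).
  by apply/equilibriumP; split=> //; apply: (nonincreasing_solution_cube_ge _ _ _ hA).
have cbrtK : (A `^ (3%:R^-1)) ^+ 3 = A.
  by rewrite -powR_mulrn ?powR_ge0// -powRrM mulVf// powRr1// ltW.
have cbrt0 : 0 < A `^ (3%:R^-1) by exact: powR_gt0.
(* Only the [A] in [A <= xbar ^+ 3] is replaced by the cube of its root; what remains is
   monotonicity of the cube on nonnegative numbers. *)
rewrite equilibriumP -[in X in _ /\ X]cbrtK; split=> [[x0]|h].
  by rewrite ler_pXn2r// nnegrE ltW.
have x0 := lt_le_trans cbrt0 h.
by split=> //; rewrite ler_pXn2r// nnegrE ltW.
Qed.
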